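(* For any prime power $q$ there is a constant $c_q>1$ such that every strong blocking set in $\mathrm{PG}(k-1,q)$ has size at least $(c_q-o(1))(q+1)(k-1)$, where $o(1)\to 0$ as $k\to\infty$. Moreover $c_q$ can be taken to be the unique solution $x\ge 1$ of \[M_q\!\left(\frac{q-1}{x(q+1)}\right)=\frac{1}{x(q+1)}.\]
   Context: $\mathrm{PG}(k-1,q)$ is the projective space whose points, ..., hyperplanes are the $1$-, ..., $(k-1)$-dimensional vector subspaces of $\mathbb{F}_q^k$. A strong blocking set is a set $S$ of points such that for every hyperplane $H$, $S\cap H$ spans $H$. The $q$-ary entropy is $H_q(x)=x\log_q(q-1)-x\log_q x-(1-x)\log_q(1-x)$, and $M_q(\delta)=H_q\!\left(\frac1q\left(q-1-(q-2)\delta-2\sqrt{(q-1)\delta(1-\delta)}\right)\right)$ (the function in the MRRW bound). *)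

(* Defs.v *)
From HB Require Import structures.
From mathcomp Require Import all_boot all_order all_algebra all_field.
From mathcomp Require Import all_classical all_reals all_analysis.
From mathcomp Require Import Rstruct Rstruct_topology.
Set Implicit Arguments. Unset Strict Implicit. Unset Printing Implicit Defensive.
Import Order.TTheory GRing.Theory Num.Theory.
Local Open Scope ring_scope.

Notation RealR := Rdefinitions.R.

Definition logb (b x : RealR) : RealR := ln x / ln b.

Definition xlogb (b x : RealR) : RealR := if x == 0 then 0 else x * logb b x.

Definition Hq (q x : RealR) : RealR :=
  x * logb q (q - 1) - xlogb q x - xlogb q (1 - x).

(* the MRRW function M_q(delta) *)
Definition Mq (q d : RealR) : RealR :=
  Hq q ((q - 1 - (q - 2) * d - 2 * Num.sqrt ((q - 1) * d * (1 - d))) / q).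

(* PG(k-1, F): points are 1-dim subspaces of F^k, hyperplanes are (k-1)-dim
   subspaces, each represented canonically by its <<_>>%MS matrix. *)
Definition PGpoints (F : finFieldType) (k : nat) : {set 'M[F]_k} :=
  [set (<<v>>)%MS | v in [set v : 'rV[F]_k | v != 0]].

Definition PGhyperplanes (F : finFieldType) (k : nat) : {set 'M[F]_k} :=
  [set (<<A>>)%MS | A in [set A : 'M[F]_k | \rank A == k.-1]].

Definition strong_blocking_set (F : finFieldType) (k : nat) (S : {set 'M[F]_k}) : Prop :=
  S \subset PGpoints F k /\
  forall H, H \in PGhyperplanes F k ->
    (\sum_(P in S | (P <= H)%MS) P == H)%MS.

Definition qR (F : finFieldType) : RealR := (#|F|)%:R.

(* Main.v *)
(* Let [n] vectors of [F^k] be such that every nonzero functional is nonzero on at least [d] of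
   them, and join [x] to [x + a g] for each of the [n] vectors [g] and all [a] in [F]: the
   nontrivial eigenvalues of this Cayley graph are at most [q (n - d)]. A nonnegative radial
   function supported on a Hamming ball of [F^n] that is an approximate eigenfunction for a
   larger value can be pushed forward to [F^k], and this forces the ball to have about [q^k]
   points (Friedman-Tillich, Navon-Samorodnitsky); with the entropy bound on balls this is the
   MRRW bound for linear codes. For a strong blocking set [S] and a hyperplane [H], the points of
   [S] outside [H] meet every affine hyperplane of the complement of [H], so the polynomial method
   (Jamison) gives [d >= (q - 1)(k - 1)]. In terms of [y = 1 / (x (q + 1))] the equation for
   [c_q] reads [M_q((q - 1) y) = y], with [M_q] continuous and strictly decreasing. *)
Require Import Defs.
From HB Require Import structures.
From mathcomp Require Import all_boot all_order all_algebra all_field.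
From mathcomp Require Import all_classical all_reals all_analysis.
From mathcomp Require Import Rstruct Rstruct_topology.
From mathcomp Require Import ring lra zify.
Set Implicit Arguments. Unset Strict Implicit. Unset Printing Implicit Defensive.
Import Order.TTheory GRing.Theory Num.Theory.
Import numFieldNormedType.Exports.
Local Open Scope ring_scope.

(** * Weights of a strong blocking set *)

(** For [e > 0] some nonzero [z] has [z ^+ e != 1], because [X^e - 1] has fewer than [q - 1] roots;
    scaling [a] by [z] multiplies the sum by [z ^+ e]. For [e = 0], translating the sum of all [a]
    by [1] shows that the ones add up to [0]. *)
Lemma sum_expr_eq0 (F : finFieldType) (e : nat) :
  (e < #|F|.-1)%N -> \sum_(a : F) a ^+ e = 0.
Proof.
have tr (b : F) (f : F -> F) : \sum_a f a = \sum_a f (a + b).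
  by rewrite (reindex_inj (addIr b)).
case: e => [|e] lt_e.
  under eq_bigr do rewrite expr0.
  apply: (@addrI _ (\sum_a a)); rewrite addr0 -big_split /=.
  exact: (esym (tr 1 id)).
have [z z0 z1] : exists2 z : F, z != 0 & z ^+ e.+1 != 1.
  have [z /andP[]|h] := pickP (fun z : F => (z != 0) && (z ^+ e.+1 != 1)); first by exists z.
  pose P : {poly F} := 'X^(e.+1) - 1%:P.
  have sz : size P = e.+2 by rewrite size_XnsubC.
  have p0 : P != 0 by rewrite -size_poly_eq0 sz.
  have : (size (enum (predC1 (0 : F)%R)) < size P)%N.
    apply: max_poly_roots => //; last exact: enum_uniq.
    apply/allP => z; rewrite mem_enum inE => z0.
    have := h z; rewrite z0 /= => /negbFE /eqP z1.
    by rewrite rootE !hornerE z1 subrr.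
  rewrite sz -cardE cardC1 => h2.
  by move: (leq_trans h2 lt_e); rewrite ltnn.
have h : \sum_(a : F) a ^+ e.+1 = z ^+ e.+1 * \sum_(a : F) a ^+ e.+1.
  rewrite {1}(reindex_inj (mulfI z0)) big_distrr /=.
  by apply: eq_bigr => a _; rewrite exprMn.
apply/eqP; move/eqP: h; rewrite -subr_eq0 -{1}[X in X - _]mul1r -mulrBl mulf_eq0 subr_eq0.
by rewrite eq_sym (negbTE z1).
Qed.

Lemma sum_col (F : finFieldType) (R : nmodType) (k : nat) (f : 'cV[F]_k -> R) :
  \sum_u f u = \sum_(h : {ffun 'I_k -> F}) f (\col_i h i).
Proof.
rewrite (reindex (fun h : {ffun 'I_k -> F} => \col_i h i)) //.
exists (fun u : 'cV[F]_k => [ffun i => u i 0]) => [h _|u _].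
  by apply/ffunP => i; rewrite ffunE mxE.
by apply/matrixP => i j; rewrite mxE ffunE ord1.
Qed.

(** As in the Chevalley-Warning theorem: the product expands into monomials of total degree below
    [k (q - 1)], so each has a variable of exponent below [q - 1], and summing over that variable
    gives [0]. *)
Lemma sum_prod_linear_eq0 (F : finFieldType) (k : nat) (s : seq 'rV[F]_k) :
  (size s < k * #|F|.-1)%N ->
  \sum_(u : 'cV[F]_k) \prod_(p <- s) (p *m u) 0 0 = 0.
Proof.
move=> lt_s; rewrite sum_col.
transitivity (\sum_(h : {ffun 'I_k -> F}) \sum_(f : {ffun 'I_(size s) -> 'I_k})
   (\prod_j (tnth (in_tuple s) j) 0 (f j)) * \prod_j h (f j)).
  apply: eq_bigr => h _; rewrite big_tnth.
  under eq_bigr do rewrite mxE.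
  rewrite bigA_distr_bigA; apply: eq_bigr => f _.
  by rewrite -big_split; apply: eq_bigr => j _; rewrite mxE.
rewrite exchange_big /= big1 // => f _.
rewrite -big_distrr /=.
pose c i := #|[set j | f j == i]|.
have -> : \sum_(h : {ffun 'I_k -> F}) \prod_j h (f j) = \prod_i \sum_a a ^+ (c i).
  rewrite bigA_distr_bigA; apply: eq_bigr => h _.
  rewrite (partition_big f xpredT) //=; apply: eq_bigr => i _.
  rewrite (eq_bigr (fun=> h i)) => [|j /eqP-> //].
  by rewrite prodr_const /c cardsE.
have [i ci] : exists i, (c i < #|F|.-1)%N.
  apply/existsP; apply: contraLR lt_s => /existsPn h.
  rewrite -leqNgt; have -> : size s = (\sum_i c i)%N.
    rewrite /c -[LHS]card_ord -sum1_card (partition_big f xpredT) //=.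
    by apply: eq_bigr => i _; rewrite sum1_card cardsE.
  rewrite -{1}(card_ord k) -sum_nat_const; apply: leq_sum => i _.
  by rewrite leqNgt.
by rewrite (bigD1 i) //= sum_expr_eq0 // mul0r mulr0.
Qed.

(** Jamison's argument. For [v] off the line of [u], the last hypothesis gives some [g i] that kills
    [v] but not [u], so the product of the forms [g i], [i] in [W], vanishes off that line. If [W]
    were small, the sum of a padded product over the whole space would be [0], but its sum over the
    line is not. *)
Lemma weight_lower_bound (F : finFieldType) (k : nat) (T : finType) (g : T -> 'rV[F]_k)
    (u : 'cV[F]_k) :
  (1 < k)%N -> u != 0 ->
  (forall v : 'cV[F]_k, (forall i, (g i *m v) 0 0 = 0 -> (g i *m u) 0 0 = 0) ->
     exists a, v = a *: u) ->
  (#|F|.-1 * k.-1 <= #|[set i | ((g i *m u) 0 0 != 0)%R]|)%N.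
Proof.
move=> k1 u0 hu; set W := [set i | _]; rewrite leqNgt; apply/negP => ltW.
have q1 : (0 < #|F|.-1)%N by rewrite ltn_predRL finNzRing_gt1.
have [p pu] : exists p : 'rV[F]_k, (p *m u) 0 0 = 1.
  have /cV0Pn[i ui] := u0.
  exists ((u i 0)^-1 *: delta_mx 0 i); rewrite -scalemxAl -rowE !mxE mulVf //.
(* Copies of [p] pad the degree to exactly [(q - 1)(k - 1)]: below [k (q - 1)], yet a positive
   multiple of [q - 1], so each [a *: u] with [a != 0] contributes the same [c]. *)
pose e := (#|F|.-1 * k.-1 - #|W|)%N.
pose s := nseq e p ++ [seq g i | i <- enum W].
have szs : size s = (#|F|.-1 * k.-1)%N.
  by rewrite size_cat size_nseq size_map -cardE subnK // ltnW.
have := @sum_prod_linear_eq0 F k s; rewrite szs [X in (_ < X)%N]mulnC ltn_mul2l q1.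
rewrite prednK ?leqnn ?(ltnW k1) // => /(_ isT).
pose c := \prod_(i in W) (g i *m u) 0 0.
have c0 : c != 0 by apply/prodf_neq0 => i; rewrite inE.
have valE v : \prod_(p <- s) (p *m v) 0 0 = (p *m v) 0 0 ^+ e * \prod_(i in W) (g i *m v) 0 0.
  rewrite big_cat /= big_map big_enum /=; congr (_ * _).
  by rewrite big_nseq; elim: (e) => [|n IH] //=; rewrite exprS IH.
have pau a : (p *m (a *: u)) 0 0 = a by rewrite -scalemxAr mxE pu mulr1.
have -> : \sum_(v : 'cV[F]_k) \prod_(p <- s) (p *m v) 0 0 =
    \sum_(a : F) \prod_(p <- s) (p *m (a *: u)) 0 0.
  have inj : injective (fun a : F => a *: u).
    move=> a b /(congr1 (fun v => (p *m v) 0 0)).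
    by rewrite /= !pau.
  rewrite (bigID (fun v : 'cV[F]_k => v \in [set a *: u | a : F])) /= [X in _ + X]big1 ?addr0.
    rewrite big_imset /=; last by move=> a b _ _ /inj.
    by apply: eq_bigl => a.
  move=> v vN; rewrite valE.
  have [i /andP[iW vi]|h] := pickP (fun i => (i \in W) && ((g i *m v) 0 0 == 0)).
    by rewrite (bigD1 i) //= (eqP vi) mul0r mulr0.
  have [i gv|a va] := hu v.
    by apply/eqP; have := h i; rewrite inE gv eqxx andbT => /negbFE.
  by case/imsetP: vN; exists a.
under eq_bigr => a _.
  rewrite valE pau.
  under eq_bigr do rewrite -scalemxAr mxE.
  rewrite big_split /= prodr_const mulrA -exprD subnK ?(ltnW ltW) // -/c.
  over.
rewrite -big_distrl /=; move/eqP; rewrite mulf_eq0 (negbTE c0) orbF => /eqP.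
apply/eqP.
have m0 : (#|F|.-1 * k.-1 != 0)%N by rewrite -lt0n muln_gt0 q1 ltn_predRL k1.
rewrite (bigD1 0) //= expr0n (negbTE m0) add0r.
rewrite (eq_bigr (fun=> 1)) => [|a a0]; last first.
  rewrite exprM; suff -> : a ^+ #|F|.-1 = 1 by rewrite expr1n.
  apply: (mulfI a0); rewrite mulr1 -exprS prednK ?expf_card //.
  exact: ltnW (finNzRing_gt1 F).
have <- : -1 = \sum_(a : F | a != 0) 1 :> F.
  apply/eqP; rewrite eq_sym -addr_eq0 addrC.
  have := @sum_expr_eq0 F 0 q1; under eq_bigr do rewrite expr0.
  by rewrite (bigD1 0) //= => ->.
by rewrite oppr_eq0 oner_neq0.
Qed.

Lemma kermx_col_sub (F : fieldType) (k : nat) (u v : 'cV[F]_k) :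
  v != 0 -> (kermx v <= kermx u)%MS -> exists a, u = a *: v.
Proof.
move=> /cV0Pn[i vi] sub; exists (u i 0 / v i 0); apply/colP => j; rewrite mxE.
(* This row kills [v], hence [u], which ties coordinate [j] of [u] to the pivot [i]. *)
pose w : 'rV[F]_k := v i 0 *: delta_mx 0 j - v j 0 *: delta_mx 0 i.
have wE (x : 'cV[F]_k) : (w *m x) 0 0 = v i 0 * x j 0 - v j 0 * x i 0.
  by rewrite mulmxBl -!scalemxAl -!rowE !mxE.
have : (w <= kermx v)%MS.
  by apply/sub_kermxP/matrixP => a b; rewrite !ord1 wE mxE mulrC subrr.
move=> /submx_trans/(_ sub)/sub_kermxP/matrixP/(_ 0 0).
rewrite wE mxE => /eqP; rewrite subr_eq0 => /eqP h.
by apply: (mulfI vi); rewrite h mulrCA mulrA mulrC divfK // mulrC.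
Qed.

(** If every point of [S] in [ker v] also lies in [ker u], then [ker v] is inside [ker u], as those
    points span it, and [u] is proportional to [v]. This is what [weight_lower_bound] asks for. *)
Lemma strong_blocking_weight (F : finFieldType) (k : nat) (S : {set 'M[F]_k})
    (u : 'cV[F]_k) :
  (1 < k)%N -> strong_blocking_set S -> u != 0 ->
  (#|F|.-1 * k.-1 <= #|[set P in S | ((nz_row P *m u) 0 0 != 0)%R]|)%N.
Proof.
move=> k1 [/fintype.subsetP Spt Sbl] u0.
have pt P (x : 'cV[F]_k) : P \in S -> (P <= kermx x)%MS = ((nz_row P *m x) 0 0 == 0).
  move=> /Spt/imsetP[v]; rewrite inE => v0 ->.
  (* A point is stored as a square matrix of rank one; a nonzero row of it serves as its
     representative vector. *)
  have gv : (nz_row <<v>> :=: <<v>>)%MS.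
    apply/eqmxP; rewrite nz_row_sub /= genmxE.
    have le : (nz_row <<v>> <= v)%MS by rewrite -(genmxE v) nz_row_sub.
    by rewrite -(mxrank_leqif_sup le) !rank_rV nz_row_eq0 -!mxrank_eq0 genmxE.
  rewrite -gv; apply/sub_kermxP/eqP => [->|h]; first by rewrite mxE.
  by apply/matrixP => a b; rewrite !ord1 h mxE.
pose g (i : {P | P \in S}) := nz_row (val i).
have := @weight_lower_bound F k _ g u k1 u0; rewrite -(card_imset _ val_inj).
suff -> : [set val x | x in [set i | (g i *m u) 0 0 != 0]] =
    [set P in S | (nz_row P *m u) 0 0 != 0].
  apply=> v hv.
  have [->|v0] := eqVneq v 0; first by exists 0; rewrite scale0r.
  have Hv : (<<kermx v>>)%MS \in PGhyperplanes F k.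
    apply/imsetP; exists (kermx v) => //; rewrite inE mxrank_ker.
    by rewrite -mxrank_tr rank_rV (raddf_eq0 _ (@trmx_inj _ _ _)) v0 subn1.
  have [a ua] : exists a, u = a *: v.
    apply: kermx_col_sub => //.
    have /eqmxP e := Sbl _ Hv; rewrite -(genmxE (kermx v)) -e.
    apply/sumsmx_subP => P /andP[PS]; rewrite genmxE !pt // => /eqP h.
    by apply/eqP; apply: (hv (Sub P PS)).
  have a0 : a != 0 by apply: contraNneq u0 => a0; rewrite ua a0 scale0r.
  by exists a^-1; rewrite ua scalerA mulVf // scale1r.
apply/setP => P; rewrite !inE; apply/imsetP/andP => [[[Q QS]]|[PS h]].
  by rewrite inE => h ->.
by exists (Sub P PS); rewrite ?inE.
Qed.

(** * The spectral bound *)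

Lemma card_submx (F : finFieldType) (m k : nat) (A : 'M[F]_(m, k)) :
  #|[set w : 'rV[F]_k | (w <= A)%MS]| = (#|F| ^ \rank A)%N.
Proof.
have inj : injective (fun x : 'rV[F]_(\rank A) => x *m row_base A).
  exact: row_free_inj (row_base_free A).
rewrite -[\rank A]mul1n -card_mx -(card_imset _ inj); apply: eq_card => w.
rewrite inE -(eq_row_base A); apply/submxP/imsetP => [[x ->]|[x _ ->]]; first by exists x.
by exists x.
Qed.

Lemma card_cV_ker (F : finFieldType) (k m : nat) (M : 'M[F]_(m, k)) :
  #|[set u : 'cV[F]_k | (M *m u == 0)%R]| = (#|F| ^ (k - \rank M))%N.
Proof.
rewrite -(mxrank_tr M) -mxrank_ker -card_submx -(card_imset _ (@trmx_inj F k 1)).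
apply: eq_card => w; rewrite !inE; apply/imsetP/sub_kermxP => [[u]|h].
  by rewrite inE => /eqP h ->; rewrite -trmx_mul h trmx0.
by exists w^T; rewrite ?trmxK // inE -(inj_eq (@trmx_inj _ _ _)) trmx_mul trmxK h trmx0.
Qed.

(* [C] does not depend on [w], so its contribution vanishes against mean-zero functions. *)
Lemma card_cV_ker2 (F : finFieldType) (k : nat) (g : 'rV[F]_k) : (1 < k)%N ->
  exists C : nat, forall w : 'rV[F]_k,
  (#|F| ^ 2 * #|[set u : 'cV[F]_k | ((g *m u == 0) && (w *m u == 0))%R]| =
   C + #|F|.-1 * #|F| ^ k * #|[set a | (w == a *: g)%R]|)%N.
Proof.
move=> k1.
have q0 : (0 < #|F|)%N by apply: ltnW (finNzRing_gt1 F).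
(* For [w] off the span of [g] the pair has rank [2], or [1] when [g = 0]; the exponent makes up for
   this. *)
exists (#|F| ^ (k + (g == 0)%R))%N => w.
have -> : [set u : 'cV[F]_k | (g *m u == 0) && (w *m u == 0)] =
    [set u : 'cV[F]_k | col_mx g w *m u == 0].
  by apply/setP => u; rewrite !inE mul_col_mx col_mx_eq0.
rewrite card_cV_ker.
have [wg|wg] := boolP (w <= g)%MS.
  have -> : \rank (col_mx g w) = (g != 0).
    rewrite -addsmxE; have /addsmx_idPl -> := wg.
    by rewrite rank_rV.
  have [g0|g0] /= := eqVneq g 0.
    move: wg; rewrite g0 => /submx0null ->.
    have -> : [set a : F | 0 == a *: (0 : 'rV[F]_k)] = [set: F].
      by apply/setP => a; rewrite !inE scaler0 eqxx.
    rewrite finset.cardsT subn0 -[in RHS]mulnA -expnSr addn1 -mulSn prednK //.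
    by rewrite -expnD -expnS addnC addn2.
  have [a wa] := sub_rVP wg.
  have -> : [set b : F | w == b *: g] = [set a].
    apply/setP => b; rewrite !inE wa eq_sym -subr_eq0 -scalerBl scaler_eq0 (negbTE g0) orbF.
    by rewrite subr_eq0.
  by rewrite cards1 muln1 addn0 -mulSn prednK // -expnD -expnS; congr (_ ^ _)%N; lia.
have -> : [set a : F | w == a *: g] = finset.set0.
  apply/setP => a; rewrite !inE; apply: contraNF wg => /eqP->.
  exact: scalemx_sub.
have w0 : w != 0 by apply: contraNneq wg => ->; rewrite sub0mx.
rewrite cards0 muln0 addn0 -expnD; congr (_ ^ _)%N.
have -> : \rank (col_mx g w) = ((g != 0)%R + 1)%N.
  rewrite -addsmxE; apply/eqP; rewrite eqn_leq.
  have := (mxrank_adds_leqif g w).1; rewrite !rank_rV w0 => -> /=.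
  have lt : (g < g + w)%MS by rewrite /ltmx addsmxSl addsmx_sub submx_refl.
  by move: lt; rewrite ltmxErank => /andP[_]; rewrite rank_rV addn1.
by case: (g == 0) => /=; lia.
Qed.

Lemma sum_fiber_sqr (R : comPzRingType) (X Y : finType) (f : X -> Y) (phi : X -> R) :
  \sum_b (\sum_(x | f x == b) phi x) ^+ 2 =
  \sum_x \sum_(z | f z == f x) phi x * phi z.
Proof.
rewrite [RHS](partition_big f xpredT) //=; apply: eq_bigr => b _.
rewrite expr2 big_distrl /=; apply: eq_bigr => x /eqP <-.
by rewrite big_distrr.
Qed.

(** Parseval without characters. After expanding the squares, the pair [(x, z)] is weighted by the
    number of [u] killed by both [g] and [z - x]. By [card_cV_ker2] this is a constant, which mean
    zero cancels, plus a term supported on the line [z = x + a *: g]. *)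
Lemma hyperplane_energy (F : finFieldType) (R : realFieldType) (k : nat)
    (g : 'rV[F]_k) (phi : 'rV[F]_k -> R) :
  (1 < k)%N -> \sum_x phi x = 0 ->
  (#|F| ^ 2)%:R * \sum_(u : 'cV[F]_k | g *m u == 0)
      \sum_b (\sum_(x | x *m u == b) phi x) ^+ 2 =
  (#|F|.-1 * #|F| ^ k)%:R * \sum_x \sum_a phi x * phi (x + a *: g).
Proof.
move=> k1 phi0; have [C cE] := card_cV_ker2 g k1.
under eq_bigr do rewrite sum_fiber_sqr.
rewrite exchange_big !mulr_sumr /=; apply: eq_bigr => x _.
have -> : \sum_(u : 'cV[F]_k | g *m u == 0) \sum_(z | z *m u == x *m u) phi x * phi z =
  \sum_z #|[set u : 'cV[F]_k | (g *m u == 0) && ((z - x) *m u == 0)]|%:R * (phi x * phi z).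
  rewrite (exchange_big_dep xpredT) //=; apply: eq_bigr => z _.
  rewrite sumr_const mulr_natl; congr (_ *+ _).
  by apply: eq_card => u; rewrite !inE mulmxBl subr_eq0.
rewrite !mulr_sumr /=.
under eq_bigr do rewrite mulrA -natrM cE natrD mulrDl.
rewrite big_split /=.
rewrite -!mulr_sumr phi0 !mulr0 add0r.
under eq_bigr do rewrite natrM -mulrA.
rewrite -mulr_sumr /=; congr (_ * _).
under eq_bigr do rewrite mulrCA; rewrite -mulr_sumr /=; congr (_ * _).
under eq_bigr do rewrite mulr_natl -sumr_const.
rewrite (exchange_big_dep xpredT) //=; apply: eq_bigr => a _.
rewrite (big_pred1 (x + a *: g)) // => z.
by rewrite /= inE subr_eq addrC.
Qed.

(** The eigenvalue bound [q (n - d)]: summing [hyperplane_energy] over [i] counts each nonzero [u]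
    once for every [g i] that kills it, at most [n - d] times, and [u = 0] contributes nothing. *)
Lemma line_energy_mean0 (F : finFieldType) (R : realFieldType) (k : nat) (I : finType)
    (g : I -> 'rV[F]_k) (d : nat) (phi : 'rV[F]_k -> R) :
  (1 < k)%N -> \sum_x phi x = 0 ->
  (forall u : 'cV[F]_k, u != 0 -> (d <= #|[set i | ((g i *m u) != 0)%R]|)%N) ->
  \sum_i \sum_x \sum_a phi x * phi (x + a *: g i) <=
  #|F|%:R * (#|I|%:R - d%:R) * \sum_x phi x ^+ 2.
Proof.
move=> k1 phi0 wt.
have q1 := finNzRing_gt1 F.
pose A (u : 'cV[F]_k) := \sum_b (\sum_(x | x *m u == b) phi x) ^+ 2.
have A0 (u : 'cV[F]_k) : 0 <= A u by apply: sumr_ge0 => b _; rewrite sqr_ge0.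
have Az : A 0 = 0.
  rewrite /A (bigD1 0) //= [X in _ + X]big1 ?addr0 => [|b b0].
    rewrite (eq_bigl xpredT) ?phi0 ?expr0n // => x.
    by rewrite mulmx0 eqxx.
  by rewrite big_pred0 ?expr0n // => x; rewrite mulmx0 eq_sym (negbTE b0).
have c0 : 0 < (#|F|.-1 * #|F| ^ k)%:R :> R.
  by rewrite ltr0n muln_gt0 expn_gt0 ltn_predRL q1 (ltnW q1).
rewrite -(ler_pM2l c0).
have -> : (#|F|.-1 * #|F| ^ k)%:R * (#|F|%:R * (#|I|%:R - d%:R) * \sum_x phi x ^+ 2) =
  (#|I|%:R - d%:R) * ((#|F| ^ 2)%:R * \sum_u A u) :> R.
  (* With [g = 0] the identity evaluates the total over all [u] as a multiple of the squared norm of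
     [phi]. *)
  have := hyperplane_energy 0 k1 phi0.
  under eq_bigl do rewrite mul0mx eqxx.
  under [in X in _ = X -> _]eq_bigr => x _.
    under eq_bigr do rewrite scaler0 addr0 -expr2.
    rewrite sumr_const -mulr_natl; over.
  by rewrite -mulr_sumr /= => ->; ring.
rewrite big_distrr /=.
under eq_bigr do rewrite -hyperplane_energy // -/(A _).
rewrite -mulr_sumr /= mulrCA ler_wpM2l // (exchange_big_dep xpredT) //= big_distrr /=.
apply: ler_sum => u _; have [->|u0] := eqVneq u 0; first by rewrite Az mulr0 big1.
rewrite sumr_const -/(A u) -[X in X <= _]mulr_natl ler_wpM2r //.
rewrite lerBrDr -natrD ler_nat.
have -> : #|I| = (#|[pred i | g i *m u == 0%R]| + #|[set i | ((g i *m u) != 0)%R]|)%N.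
  rewrite -(cardC [pred i | g i *m u == 0]); congr (_ + _)%N.
  by apply: eq_card => i; rewrite !inE.
by rewrite leq_add2l wt.
Qed.

(** Subtract the mean. Constants have eigenvalue [q n], which exceeds [q (n - d)] by [q d]; hence
    the extra term. *)
Lemma line_energy_le (F : finFieldType) (R : realFieldType) (k : nat) (I : finType)
    (g : I -> 'rV[F]_k) (d : nat) (phi : 'rV[F]_k -> R) :
  (1 < k)%N ->
  (forall u : 'cV[F]_k, u != 0 -> (d <= #|[set i | ((g i *m u) != 0)%R]|)%N) ->
  \sum_i \sum_x \sum_a phi x * phi (x + a *: g i) <=
  #|F|%:R * (#|I|%:R - d%:R) * \sum_x phi x ^+ 2
  + #|F|%:R * d%:R * (\sum_x phi x) ^+ 2 / (#|F| ^ k)%:R.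
Proof.
move=> k1 wt; set N := (#|F| ^ k)%:R; set s := \sum_x phi x.
have N0 : N != 0 :> R by rewrite pnatr_eq0 -lt0n expn_gt0 (ltnW (finNzRing_gt1 F)).
have card_V : #|'rV[F]_k|%:R = N :> R by rewrite card_mx mul1n.
pose psi x := phi x - s / N.
have psi0 : \sum_x psi x = 0.
  by rewrite sumrB sumr_const -mulr_natr card_V divfK // subrr.
have sqE : \sum_x psi x ^+ 2 = \sum_x phi x ^+ 2 - s ^+ 2 / N.
  under eq_bigr do rewrite /psi sqrrB.
  rewrite !big_split /= sumr_const -mulr_natr card_V sumrN -/s.
  rewrite [X in _ - X](eq_bigr (fun x => (2 * (s / N)) * phi x)) => [|x _]; last by ring.
  by rewrite -mulr_sumr /= -/s; field.
have lnE i : \sum_x \sum_a psi x * psi (x + a *: g i) =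
   \sum_x \sum_a phi x * phi (x + a *: g i) - #|F|%:R * s ^+ 2 / N.
  rewrite exchange_big [in RHS]exchange_big /=.
  have -> : #|F|%:R * s ^+ 2 / N = \sum_(a : F) s ^+ 2 / N.
    by rewrite sumr_const -[RHS]mulr_natl mulrA.
  rewrite -sumrB; apply: eq_bigr => a _.
  have sh : \sum_x phi (x + a *: g i) = s by rewrite /s [RHS](reindex_inj (addIr (a *: g i))).
  under eq_bigr => x _.
    have -> : psi x * psi (x + a *: g i) = phi x * phi (x + a *: g i)
       - (s / N) * phi x - (s / N) * phi (x + a *: g i) + (s / N) ^+ 2.
      by rewrite /psi; ring.
    over.
  rewrite !big_split /= !sumrN -!mulr_sumr /= sh -/s sumr_const -mulr_natr card_V.
  by field.
have := line_energy_mean0 k1 psi0 wt.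
under eq_bigr do rewrite lnE.
rewrite sumrB sqE sumr_const -mulr_natr lerBlDr => h; apply: (le_trans h).
by rewrite le_eqVlt; apply/orP; left; apply/eqP; field.
Qed.

(** Cauchy-Schwarz on the support, from the double sum of [(phi x - phi y) ^+ 2]. *)
Lemma sqr_sum_le_supp (R : realFieldType) (X : finType) (D : {set X}) (phi : X -> R) :
  (forall x, x \notin D -> phi x = 0) ->
  (\sum_x phi x) ^+ 2 <= #|D|%:R * \sum_x phi x ^+ 2.
Proof.
move=> out.
have red (h : R -> R) : h 0 = 0 -> \sum_x h (phi x) = \sum_(x in D) h (phi x).
  move=> h0; rewrite (bigID (mem D)) /= [X in _ + X]big1 ?addr0 // => x xD.
  by rewrite out.
rewrite (red id) // (red (fun y => y ^+ 2)) ?expr0n //.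
set s := \sum_(x in D) id _; set E := \sum_(x in D) _.
have : 0 <= \sum_(x in D) \sum_(y in D) (phi x - phi y) ^+ 2.
  by apply: sumr_ge0 => x _; apply: sumr_ge0 => y _; rewrite sqr_ge0.
suff -> : \sum_(x in D) \sum_(y in D) (phi x - phi y) ^+ 2 = 2 * (#|D|%:R * E - s ^+ 2).
  by rewrite pmulr_rge0 ?subr_ge0 // ltr0n.
transitivity (\sum_(x in D) (#|D|%:R * phi x ^+ 2 + (- (2 * phi x * s) + E))).
  apply: eq_bigr => x _.
  under eq_bigr => y _.
    have -> : (phi x - phi y) ^+ 2 = phi x ^+ 2 + (- (2 * phi x * phi y) + phi y ^+ 2) by ring.
    over.
  by rewrite !big_split /= sumrN sumr_const -[X in X + _]mulr_natl -mulr_sumr.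
rewrite !big_split /= sumrN sumr_const -mulr_sumr -mulr_suml -mulr_sumr -[X in _ + (_ + X)]mulr_natl.
by rewrite -/E -/s; ring.
Qed.

Definition single (F : finFieldType) (I : finType) (i : I) (a : F) : {ffun I -> F} :=
  [ffun j => if j == i then a else 0].

(* Push [f] forward to [F^k] along [x |-> sum_i x_i g_i] and compare with the spectral bound there. *)
Lemma support_lower_bound (F : finFieldType) (R : realFieldType) (k : nat) (I : finType)
    (g : I -> 'rV[F]_k) (d : nat) (f : {ffun I -> F} -> R) (L : R) :
  (1 < k)%N ->
  (forall u : 'cV[F]_k, u != 0 -> (d <= #|[set i | ((g i *m u) != 0)%R]|)%N) ->
  (forall x, 0 <= f x) -> 0 < \sum_x f x ->
  (forall x, L * f x <= \sum_i \sum_a f (x + single i a)) ->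
  (#|F| ^ k)%:R * (L - #|F|%:R * (#|I|%:R - d%:R)) <=
  #|F|%:R * d%:R * #|[set x | (f x != 0)%R]|%:R.
Proof.
move=> k1 wt f0 fpos fL.
pose pr (x : {ffun I -> F}) := \sum_i x i *: g i.
have prD x i a : pr (x + single i a) = pr x + a *: g i.
  rewrite /pr; under eq_bigr do rewrite ffunE scalerDl.
  rewrite big_split /=; congr (_ + _).
  rewrite (bigD1 i) //= big1 ?addr0 => [|j /negbTE ji]; first by rewrite ffunE eqxx.
  by rewrite ffunE ji scale0r.
pose phi v := \sum_(x | pr x == v) f x.
have phi0 v : 0 <= phi v by apply: sumr_ge0.
have phiL v : L * phi v <= \sum_i \sum_a phi (v + a *: g i).
  rewrite /phi mulr_sumr; apply: le_trans (ler_sum _ (fun x _ => fL x)) _.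
  rewrite exchange_big /= ler_sum // => i _.
  rewrite exchange_big /= ler_sum // => a _.
  rewrite [leRHS](reindex_inj (addIr (single i a))) /=.
  by under [leRHS]eq_bigl do rewrite prD (inj_eq (addIr _)).
have phis : \sum_v phi v = \sum_x f x by rewrite [RHS](partition_big pr xpredT).
pose D := [set v | phi v != 0].
have cs := @sqr_sum_le_supp R _ D phi.
have DB : (#|D| <= #|[set x | (f x != 0)%R]|)%N.
  apply: leq_trans (leq_imset_card pr _); apply/subset_leq_card/fintype.subsetP => v.
  rewrite inE => /eqP pv; apply/imsetP.
  have [x /andP[fx /eqP px]|h] := pickP (fun x => (f x != 0) && (pr x == v)).
    by exists x; rewrite ?inE.
  case: pv; apply: big1 => x /eqP px.
  by apply/eqP; have := h x; rewrite px eqxx andbT => /negbFE.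
set E := \sum_v phi v ^+ 2 in cs *.
set s := \sum_v phi v in cs phis *.
(* The pushforward has no larger support than [f], so [s ^+ 2] is bounded by a multiple of [E],
   which is divided out at the end. *)
have {}cs : s ^+ 2 <= #|[set x | f x != 0]|%:R * E.
  apply: le_trans (cs _) _; first by move=> v; rewrite inE negbK => /eqP.
  by rewrite ler_wpM2r ?ler_nat // sumr_ge0 // => v _; rewrite sqr_ge0.
have s0 : 0 < s ^+ 2 by rewrite exprn_gt0 // phis.
have E0 : 0 < E.
  rewrite lt_neqAle sumr_ge0 ?andbT => [|v _]; last by rewrite sqr_ge0.
  by apply: contraTneq s0 => e0; rewrite -leNgt (le_trans cs) // -e0 mulr0.
have N0 : 0 < (#|F| ^ k)%:R :> R by rewrite ltr0n expn_gt0 (ltnW (finNzRing_gt1 F)).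
have en := line_energy_le phi k1 wt.
have LE : L * E <= \sum_i \sum_x \sum_a phi x * phi (x + a *: g i).
  rewrite exchange_big /= /E mulr_sumr ler_sum // => v _.
  rewrite expr2 mulrCA; apply: le_trans (ler_wpM2l (phi0 v) (phiL v)) _.
  rewrite mulr_sumr ler_sum // => i _.
  by rewrite mulr_sumr.
set B := #|[set x | _]|%:R in cs *.
have h : L * E <= #|F|%:R * (#|I|%:R - d%:R) * E + #|F|%:R * d%:R * (B * E) / (#|F| ^ k)%:R.
  apply: le_trans LE (le_trans en _); rewrite lerD2l ler_pM2r ?invr_gt0 //.
  by rewrite ler_wpM2l // mulr_ge0 // ler0n.
rewrite -(ler_pM2r E0) mulrBr mulrBl lerBlDl.
have -> : (#|F| ^ k)%:R * L * E = L * E * (#|F| ^ k)%:R by ring.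
apply: le_trans (ler_wpM2r (ltW N0) h) _.
rewrite mulrDl divfK ?gt_eqF // le_eqVlt; apply/orP; left; apply/eqP; ring.
Qed.

(** * Radial functions and Hamming balls *)

Definition hwt (F : finFieldType) (I : finType) (x : {ffun I -> F}) : nat :=
  \sum_i (x i != 0)%R.

Lemma hwt_le (F : finFieldType) (I : finType) (x : {ffun I -> F}) : (hwt x <= #|I|)%N.
Proof. by rewrite -sum1_card; apply: leq_sum => i _; case: (_ != _). Qed.

(** Resetting a nonzero coordinate lowers the weight for one value and keeps it for the [q - 1]
    others; resetting a zero coordinate keeps it for one and raises it for [q - 1]. At weight [0]
    the predecessor term has coefficient [0]. *)
Lemma sum_radial (F : finFieldType) (R : comPzRingType) (I : finType) (G : nat -> R)
    (x : {ffun I -> F}) :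
  \sum_i \sum_a G (hwt (x + single i a)) =
  (hwt x)%:R * (G (hwt x).-1 + #|F|.-1%:R * G (hwt x))
  + (#|I| - hwt x)%:R * (G (hwt x) + #|F|.-1%:R * G (hwt x).+1).
Proof.
pose w' i := (\sum_(j | j != i) (x j != 0)%R)%N.
have wE i : hwt x = ((x i != 0)%R + w' i)%N by rewrite /hwt (bigD1 i).
have sumE i : \sum_a G (hwt (x + single i a)) = G (w' i) + #|F|.-1%:R * G (w' i).+1.
  rewrite (reindex_inj (addrI (- x i))) /=.
  have e a : hwt (x + single i (- x i + a)) = ((a != 0)%R + w' i)%N.
    rewrite /hwt (bigD1 i) //= !ffunE eqxx addNKr; congr (_ + _)%N.
    by apply: eq_bigr => j /negbTE ji; rewrite !ffunE ji addr0.
  under eq_bigr do rewrite e.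
  rewrite (bigD1 0) //= eqxx add0n; congr (_ + _).
  rewrite (eq_bigr (fun=> G (w' i).+1)) => [|a -> //].
  by rewrite sumr_const mulr_natl cardC1.
under eq_bigr do rewrite sumE.
rewrite (bigID (fun i => x i != 0)) /=.
have cE : #|[pred i | x i != 0]| = hwt x.
  rewrite /hwt -sum1_card big_mkcond /=; apply: eq_bigr => i _; rewrite inE; by case: (x i != 0).
congr (_ + _).
  rewrite (eq_bigr (fun=> G (hwt x).-1 + #|F|.-1%:R * G (hwt x))).
    by rewrite sumr_const [RHS]mulr_natl -cE.
  by move=> i xi; rewrite (wE i) xi.
rewrite (eq_bigr (fun=> G (hwt x) + #|F|.-1%:R * G (hwt x).+1)).
  rewrite sumr_const [RHS]mulr_natl -cE; congr (_ *+ _).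
  by rewrite -(cardC [pred i | x i != 0]) addKn; apply: eq_card => i; rewrite !inE.
by move=> i /negbTE xi; rewrite (wE i) xi.
Qed.

Lemma sum_expr_hwt (F : finFieldType) (R : comPzRingType) (I : finType) (t : R) :
  \sum_(x : {ffun I -> F}) t ^+ hwt x = (1 + #|F|.-1%:R * t) ^+ #|I|.
Proof.
have -> : 1 + #|F|.-1%:R * t = \sum_(a : F) t ^+ (a != 0).
  rewrite (bigD1 0) //= eqxx expr0; congr (_ + _).
  rewrite (eq_bigr (fun=> t)) => [|a -> //].
  by rewrite sumr_const mulr_natl cardC1.
rewrite -prodr_const bigA_distr_bigA; apply: eq_bigr => x _.
by rewrite /hwt expr_sum.
Qed.

(** Chernoff's bound: since [t <= 1], each point of the ball weighs at least [t ^+ r] in the weight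
    enumerator. *)
Lemma card_ball_le (F : finFieldType) (R : realFieldType) (I : finType) (r : nat) (t : R) :
  0 <= t <= 1 ->
  #|[set x : {ffun I -> F} | (hwt x <= r)%N]|%:R * t ^+ r <= (1 + #|F|.-1%:R * t) ^+ #|I|.
Proof.
move=> /andP[t0 t1]; rewrite -sum_expr_hwt mulr_natl -sumr_const.
rewrite [leRHS](bigID (mem [set x | (hwt x <= r)%N])) /=.
rewrite -[leLHS]addr0 lerD ?sumr_ge0 // => [|x _]; last exact: exprn_ge0.
by apply: ler_sum => x; rewrite inE => h; apply: ler_wiXn2l.
Qed.

Lemma exists_hwt (F : finFieldType) (I : finType) (j : nat) :
  (j <= #|I|)%N -> exists x : {ffun I -> F}, hwt x = j.
Proof.
rewrite -bin_gt0 -card_draws card_gt0 => /set0Pn[A]; rewrite inE => /eqP <-.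
exists [ffun i => (i \in A)%:R]; rewrite /hwt -sum1_card [RHS]big_mkcond /=.
by apply: eq_bigr => i _; rewrite ffunE; case: (i \in A); rewrite ?oner_eq0 ?eqxx.
Qed.

(* [a b] is the value of the bump [h j = (j - l)(r - j)] at [j = l + a = r - b]. Its second
   difference is [-2] and [h >= a + b - 1] inside its support, whence the loss [2 s / (a + b - 1)]. *)
Lemma bump_recurrence (R : realFieldType) (Q rho s t n w a b : R) :
  0 <= Q -> 0 < t -> 0 <= s -> Q * t * (1 - rho) = s -> rho = s * t ->
  1 <= a -> 1 <= b -> 1 < a + b -> 0 <= n ->
  rho * n - (a + b + 1) <= w -> (1 - rho) * n <= n - w ->
  (n * (Q * rho + 1 - rho + 2 * s - 2 * s / (a + b - 1)) - (a + b + 1) * (2 / t + Q))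
     * (t * (a * b))
  <= w * ((a - 1) * (b + 1) + Q * (t * (a * b)))
     + (n - w) * (t * (a * b) + Q * (t ^+ 2 * ((a + 1) * (b - 1)))).
Proof.
move=> Q0 t0 s0 sE rE a1 b1 ab1 n0 wlo whi.
have a0 : 0 < a by apply: lt_le_trans a1.
have b0 : 0 < b by apply: lt_le_trans b1.
have ab0 : 0 < a * b by rewrite mulr_gt0.
(* The brackets multiplying [w] and [n - w] are nonnegative, so both may be replaced by their lower
   bounds. *)
apply: (@le_trans _ _ ((rho * n - (a + b + 1)) * ((a - 1) * (b + 1) + Q * (t * (a * b)))
     + (1 - rho) * n * (t * (a * b) + Q * (t ^+ 2 * ((a + 1) * (b - 1)))))); last first.
  apply: lerD; apply: ler_wpM2r => //.
    by rewrite addr_ge0 ?mulr_ge0 ?subr_ge0 ?addr_ge0 // ltW.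
  rewrite addr_ge0 ?mulr_ge0 ?exprn_ge0 ?subr_ge0 ?addr_ge0 //; exact: ltW.
have -> : (rho * n - (a + b + 1)) * ((a - 1) * (b + 1) + Q * (t * (a * b)))
     + (1 - rho) * n * (t * (a * b) + Q * (t ^+ 2 * ((a + 1) * (b - 1))))
  = n * t * (s * (2 * (a * b) - 2) + (Q * rho + 1 - rho) * (a * b))
    - (a + b + 1) * ((a - 1) * (b + 1) + Q * (t * (a * b))).
  apply/eqP; rewrite -subr_eq0; apply/eqP.
  transitivity (n * ((a - 1) * (b + 1)) * (rho - s * t)
      + n * t * ((a + 1) * (b - 1)) * (Q * t * (1 - rho) - s)); first by ring.
  by rewrite sE -rE !subrr !mulr0 addr0.
have -> : (n * (Q * rho + 1 - rho + 2 * s - 2 * s / (a + b - 1))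
      - (a + b + 1) * (2 / t + Q)) * (t * (a * b)) =
   n * t * (s * (2 * (a * b) - 2 * (a * b / (a + b - 1))) + (Q * rho + 1 - rho) * (a * b))
   - (a + b + 1) * (2 * (a * b) + Q * (t * (a * b))).
  by field; rewrite gt_eqF ?subr_gt0 //= gt_eqF.
apply: lerB.
  apply: ler_wpM2l; first by rewrite mulr_ge0 // ltW.
  rewrite lerD2r; apply: ler_wpM2l => //; rewrite lerD2l lerN2.
  rewrite -[leLHS]mulr1 ler_wpM2l // ler_pdivlMr ?mul1r; nra.
apply: ler_wpM2l; first by nra.
by rewrite lerD2r; nra.
Qed.

(** The test function is [t ^+ w] times a bump on a window of width [m] just below [rho n]. The two
    equations make the rates of lowering, [rho / t], and of raising, [(q - 1) t (1 - rho)], both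
    equal to [s], so the bump sees a symmetric walk and [2 s] is lost only up to [2 s / (m - 1)]. *)
Lemma code_ball_bound (F : finFieldType) (R : realFieldType) (k : nat) (I : finType)
    (g : I -> 'rV[F]_k) (d m r : nat) (rho s t : R) :
  (1 < k)%N ->
  (forall u : 'cV[F]_k, u != 0 -> (d <= #|[set i | ((g i *m u) != 0)%R]|)%N) ->
  0 < t -> 0 <= s -> #|F|.-1%:R * t * (1 - rho) = s -> rho = s * t ->
  (1 < m)%N -> (m <= r)%N -> r%:R <= rho * #|I|%:R < r%:R + 1 -> rho <= 1 ->
  (#|F| ^ k)%:R *
    (#|I|%:R * (#|F|.-1%:R * rho + 1 - rho + 2 * s - 2 * s / (m%:R - 1))
     - (m%:R + 1) * (2 / t + #|F|.-1%:R) - #|F|%:R * (#|I|%:R - d%:R)) <=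
  #|F|%:R * d%:R * #|[set x : {ffun I -> F} | (hwt x <= r)%N]|%:R.
Proof.
move=> k1 wt t0 s0 sE rE m1 mr /andP[rlo rhi] rho1.
have rn : (r <= #|I|)%N.
  by rewrite -(ler_nat R) (le_trans rlo) // ler_piMl.
(* Truncated subtraction makes [h] vanish outside [r - m < j < r]. *)
pose h (j : nat) : R := ((j - (r - m)) * (r - j))%:R.
pose f (x : {ffun I -> F}) : R := t ^+ hwt x * h (hwt x).
have f0 x : 0 <= f x by rewrite mulr_ge0 ?exprn_ge0 ?ler0n // ltW.
have hpos j : (r - m < j < r)%N -> 0 < h j.
  by move=> /andP[l1 l2]; rewrite ltr0n muln_gt0 !subn_gt0 l1.
have fsum : 0 < \sum_x f x.
  have [x xw] : exists x : {ffun I -> F}, hwt x = (r - m).+1.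
    by apply: exists_hwt; lia.
  rewrite (bigD1 x) //= ltr_pwDl ?sumr_ge0 // mulr_gt0 ?exprn_gt0 // xw hpos //; lia.
have supp : (#|[set x | (f x != 0)%R]| <= #|[set x : {ffun I -> F} | (hwt x <= r)%N]|)%N.
  apply/subset_leq_card/fintype.subsetP => x; rewrite !inE; apply: contraNT.
  by rewrite -ltnNge /f /h => lt; rewrite (_ : r - hwt x = 0)%N ?muln0 ?mulr0 //; lia.
apply: le_trans (support_lower_bound k1 wt f0 fsum _) _; last first.
  by rewrite ler_wpM2l ?mulr_ge0 ?ler0n // ler_nat.
move=> x; rewrite /f (sum_radial (fun w => t ^+ w * h w)).
have := hwt_le x; set w := hwt x => wn.
have [/andP[l1 l2]|out] := boolP (r - m < w < r)%N; last first.
  have -> : h w = 0.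
    rewrite /h; move: out; rewrite negb_and -!leqNgt => /orP[] H.
      by rewrite (_ : w - (r - m) = 0)%N ?mul0n //; lia.
    by rewrite (_ : r - w = 0)%N ?muln0 //; lia.
  rewrite !mulr0 addr0 add0r.
  by rewrite addr_ge0 ?mulr_ge0 ?exprn_ge0 ?ler0n // ltW.
pose a := (w - (r - m))%N; pose b := (r - w)%N.
have ha : h w = a%:R * b%:R by rewrite /h natrM.
have a1 : (1 <= a)%N by rewrite /a; lia.
have b1 : (1 <= b)%N by rewrite /b; lia.
have hm : h w.-1 = (a%:R - 1) * (b%:R + 1).
  rewrite /h natrM (_ : w.-1 - (r - m) = a - 1)%N; last by rewrite /a; lia.
  rewrite (_ : r - w.-1 = b + 1)%N; last by rewrite /b; lia.
  by rewrite natrB // natrD.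
have hp : h w.+1 = (a%:R + 1) * (b%:R - 1).
  rewrite /h natrM (_ : w.+1 - (r - m) = a + 1)%N; last by rewrite /a; lia.
  rewrite (_ : r - w.+1 = b - 1)%N; last by rewrite /b; lia.
  by rewrite natrB // natrD.
have abm : m%:R = a%:R + b%:R :> R by rewrite -natrD; congr (_%:R); rewrite /a /b; lia.
have w0 : (0 < w)%N by lia.
have rwm : (r <= w + m)%N by lia.
rewrite hm hp ha abm.
have -> : t ^+ w = t ^+ w.-1 * t by rewrite -exprSr prednK.
have -> : t ^+ w.+1 = t ^+ w.-1 * t ^+ 2 by rewrite -exprD addn2 prednK.
have P0 : 0 < t ^+ w.-1 by rewrite exprn_gt0.
set P := t ^+ w.-1 in P0 *.
set Q := #|F|.-1%:R in sE *; set n := #|I|%:R in rlo rhi *.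
set A := a%:R in abm *; set B := b%:R in abm *.
have -> : (#|I| - w)%:R = n - w%:R :> R by rewrite natrB.
have br := @bump_recurrence R Q rho s t n w%:R A B.
set L := (X in X * (P * t * _)).
have -> : L * (P * t * (A * B)) = P * (L * (t * (A * B))) by ring.
have -> : w%:R * (P * ((A - 1) * (B + 1)) + Q * (P * t * (A * B))) +
    (n - w%:R) * (P * t * (A * B) + Q * (P * t ^+ 2 * ((A + 1) * (B - 1))))
  = P * (w%:R * ((A - 1) * (B + 1) + Q * (t * (A * B)))
     + (n - w%:R) * (t * (A * B) + Q * (t ^+ 2 * ((A + 1) * (B - 1))))) by ring.
have wr : w%:R <= r%:R :> R by rewrite ler_nat ltnW.
have rw : r%:R <= w%:R + m%:R :> R by rewrite -natrD ler_nat.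
have A1 : 1 <= A by rewrite ler1n.
have B1 : 1 <= B by rewrite ler1n.
have AB1 : 1 < A + B by rewrite -abm ltr1n.
have n0 : 0 <= n by rewrite ler0n.
have Q0 : 0 <= Q by rewrite ler0n.
by rewrite ler_pM2l //; apply: br => //; [rewrite -abm; lra | lra].
Qed.

(** * The function M_q *)

Lemma ln_leB1 (R : realType) (x : R) : 0 < x -> ln x <= x - 1.
Proof. by move=> x0; rewrite -{1}(subrK 1 x) addrC le_ln1Dx //; lra. Qed.

Lemma xlnx_cross_le (R : realType) (x p : R) :
  0 <= x -> 0 < p -> x * ln p - x * ln x <= p - x.
Proof.
rewrite le_eqVlt => /orP[/eqP<- p0|x0 p0]; first by rewrite !mul0r !subr0 ltW.
rewrite -mulrBr -ln_div ?posrE //.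
apply: le_trans (ler_wpM2l (ltW x0) (ln_leB1 (divr_gt0 p0 x0))) _.
by rewrite mulrBr mulr1 mulrCA divff ?gt_eqF // mulr1.
Qed.

Lemma ln_q_gt0 (q : RealR) : 2 <= q -> 0 < ln q.
Proof. by move=> q2; rewrite ln_gt0 //; lra. Qed.

Lemma HqE (q x : RealR) :
  Hq q x = (x * ln (q - 1) - x * ln x - (1 - x) * ln (1 - x)) / ln q.
Proof.
have xE y : xlogb q y = y * ln y / ln q.
  by rewrite /xlogb /logb; case: eqP => [->|_]; rewrite ?mul0r // mulrA.
by rewrite /Hq !xE /logb mulrA -!mulrBl.
Qed.

Lemma Hq_lnE (q x : RealR) : 2 <= q ->
  Hq q x * ln q = x * ln (q - 1) - x * ln x - (1 - x) * ln (1 - x).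
Proof. by move=> q2; rewrite HqE divfK // gt_eqF // ln_q_gt0. Qed.

(* Gibbs' inequality; equality at [x = p]. *)
Lemma Hq_cross_le (q x p : RealR) : 2 <= q -> 0 <= x <= 1 -> 0 < p < 1 ->
  Hq q x * ln q <= x * ln (q - 1) - x * ln p - (1 - x) * ln (1 - p).
Proof.
move=> q2 /andP[x0 x1] /andP[p0 p1]; rewrite Hq_lnE //.
have h1 := xlnx_cross_le x0 p0.
have x1' : 0 <= 1 - x by lra.
have p1' : 0 < 1 - p by lra.
have h2 := xlnx_cross_le x1' p1'.
lra.
Qed.

Lemma Hq_lt (q x p : RealR) : 2 <= q -> 0 <= x -> x < p -> p < (q - 1) / q ->
  Hq q x < Hq q p.
Proof.
move=> q2 x0 xp; rewrite ltr_pdivlMr; last by lra.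
move=> pq; have p1 : p < 1 by nra.
have p0 : 0 < p by lra.
rewrite -(ltr_pM2r (ln_q_gt0 q2)).
apply: le_lt_trans (@Hq_cross_le _ _ p q2 _ _) _; rewrite ?x0 ?p0 ?p1 //=; first by lra.
rewrite Hq_lnE //.
have : 0 < ln ((q - 1) * (1 - p) / p).
  by rewrite ln_gt0 // ltr_pdivlMr //; nra.
rewrite ln_div ?posrE ?mulr_gt0 ?lnM ?posrE; try lra.
by move=> h; nra.
Qed.

(** The argument of [Hq] in [Mq] with the square completed; the square vanishes at
    [d = (q - 1) / q]. *)
Definition mrrw_radius (q d : RealR) : RealR :=
  (Num.sqrt ((q - 1) * (1 - d)) - Num.sqrt d) ^+ 2 / q.

Lemma mrrw_radiusE (q d : RealR) : 2 <= q -> 0 <= d <= 1 ->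
  (q - 1 - (q - 2) * d - 2 * Num.sqrt ((q - 1) * d * (1 - d))) / q = mrrw_radius q d.
Proof.
move=> q2 /andP[d0 d1]; rewrite /mrrw_radius; congr (_ / q).
have h0 : 0 <= (q - 1) * (1 - d) by rewrite mulr_ge0; lra.
rewrite sqrrB !sqr_sqrtr // (mulrAC (q - 1) d) sqrtrM //; ring.
Qed.

Lemma MqE (q d : RealR) : 2 <= q -> 0 <= d <= 1 -> Mq q d = Hq q (mrrw_radius q d).
Proof. by move=> q2 d01; rewrite /Mq mrrw_radiusE. Qed.

Lemma mrrw_radius_gap (q d : RealR) : 2 <= q -> d <= (q - 1) / q ->
  Num.sqrt d <= Num.sqrt ((q - 1) * (1 - d)).
Proof.
move=> q2; rewrite ler_pdivlMr; last by lra.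
by move=> h; rewrite ler_wsqrtr //; nra.
Qed.

Lemma mrrw_radius_lt (q d1 d2 : RealR) : 2 <= q -> 0 <= d1 -> d1 < d2 -> d2 <= (q - 1) / q ->
  mrrw_radius q d2 < mrrw_radius q d1.
Proof.
move=> q2 d10 d12 d2q; rewrite /mrrw_radius ltr_pM2r ?invr_gt0; last by lra.
have d2b : d2 < 1 by apply: le_lt_trans d2q _; rewrite ltr_pdivrMr; lra.
have d1q : d1 <= (q - 1) / q by apply: le_trans d2q; exact: ltW.
rewrite ltr_pXn2r // ?nnegrE; try by rewrite subr_ge0 mrrw_radius_gap.
apply: ltrB; last by rewrite ltr_sqrt //; lra.
by rewrite ltr_sqrt ?mulr_gt0 ?ltr_pM2l; lra.
Qed.

Lemma mrrw_radius0 (q : RealR) : 2 <= q -> mrrw_radius q 0 = (q - 1) / q.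
Proof. by move=> q2; rewrite /mrrw_radius sqrtr0 !subr0 mulr1 sqr_sqrtr //; lra. Qed.

Lemma mrrw_radius_gt0 (q d : RealR) : 2 <= q -> 0 <= d -> d < (q - 1) / q ->
  0 < mrrw_radius q d.
Proof.
move=> q2 d0 dq; apply: le_lt_trans (mrrw_radius_lt q2 d0 dq (lexx _)).
by rewrite /mrrw_radius divr_ge0 ?sqr_ge0 //; lra.
Qed.

Lemma mrrw_radius_le (q d : RealR) : 2 <= q -> 0 <= d -> d <= (q - 1) / q ->
  mrrw_radius q d <= (q - 1) / q.
Proof.
move=> q2; rewrite le_eqVlt => /orP[/eqP<- _|d0 dq]; first by rewrite mrrw_radius0.
by rewrite -(mrrw_radius0 q2) ltW // mrrw_radius_lt.
Qed.

Lemma Mq_lt (q d1 d2 : RealR) : 2 <= q -> 0 < d1 -> d1 < d2 -> d2 < (q - 1) / q ->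
  Mq q d2 < Mq q d1.
Proof.
move=> q2 d10 d12 d2q.
have q1 : (q - 1) / q < 1 by rewrite ltr_pdivrMr; lra.
rewrite !MqE //; try lra.
apply: Hq_lt => //.
- by apply/ltW/mrrw_radius_gt0 => //; lra.
- by apply: mrrw_radius_lt => //; lra.
- by rewrite -(mrrw_radius0 q2); apply: mrrw_radius_lt => //; lra.
Qed.

Lemma Mq0 (q : RealR) : 2 <= q -> Mq q 0 = 1.
Proof.
move=> q2; rewrite MqE //; last by lra.
rewrite mrrw_radius0 //; apply: (mulIf (lt0r_neq0 (ln_q_gt0 q2))); rewrite Hq_lnE // mul1r.
have -> : 1 - (q - 1) / q = q^-1 by field; lra.
rewrite ln_div ?posrE ?lnV ?posrE; try lra.
by field; lra.
Qed.

(** The sign at the right end of the interval, which yields [c > 1]. Here the radius is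
    [(sqrt 2 - 1)^2 (q - 1) / (q (q + 1))], small enough for Gibbs' inequality with an explicit
    [p]. *)
Lemma Mq_endpoint_lt (q : RealR) : 2 <= q -> Mq q ((q - 1) / (q + 1)) < 1 / (q + 1).
Proof.
move=> q2; set d := (q - 1) / (q + 1).
have d01 : 0 <= d < 1 by rewrite /d divr_ge0 ?ltr_pdivrMr //; lra.
rewrite MqE //; last by lra.
set a := mrrw_radius q d.
have a0 : 0 <= a by rewrite /a /mrrw_radius divr_ge0 ?sqr_ge0 //; lra.
(* [9 / 50] is a rational upper bound for [(sqrt 2 - 1)^2 = 3 - 2 sqrt 2]. *)
have ub : a <= 9 / 50 * ((q - 1) / (q * (q + 1))).
  have -> : a = (Num.sqrt 2 - 1) ^+ 2 * ((q - 1) / (q * (q + 1))).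
    rewrite /a /mrrw_radius (_ : (q - 1) * (1 - d) = d * 2); last by rewrite /d; field; lra.
    rewrite sqrtrM; last by lra.
    rewrite -[X in _ * _ - X]mulr1 -mulrBr exprMn sqr_sqrtr; last by lra.
    by rewrite /d; field; lra.
  apply: ler_wpM2r; first by rewrite divr_ge0 ?mulr_ge0; lra.
  have s0 : 0 <= Num.sqrt (2 : RealR) by rewrite sqrtr_ge0.
  have s2 : Num.sqrt (2 : RealR) ^+ 2 = 2 by rewrite sqr_sqrtr //; lra.
  rewrite sqrrB s2; nra.
have a1 : a <= 1.
  apply: le_trans ub _; rewrite mulrA ler_pdivrMr; nra.
set s := Num.sqrt q; have s2 : s ^+ 2 = q by rewrite sqr_sqrtr; lra.
have s0 : 0 < s by rewrite sqrtr_gt0; lra.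
have s1 : 141 / 100 <= s by nra.
have lnq : 2 * (1 - 1 / s) <= ln q.
  rewrite -s2 lnXn // -[leRHS]mulr_natl ler_pM2l // -[s in ln s]invrK lnV ?posrE ?invr_gt0 //.
  by rewrite mul1r lerNr opprB; apply: ln_leB1; rewrite invr_gt0.
have q0 : 0 < q by lra.
have q30 : 0 < q ^+ 3 by rewrite exprn_gt0.
(* For [p = (q - 1) / T] the odds are [(q - 1) / q^3], so [ln (q - 1)] cancels and the cross entropy
   becomes [ln T - 3 ln q + 3 a ln q]. *)
set T := q ^+ 3 + q - 1.
have T0 : 0 < T by rewrite /T; lra.
have p0 : 0 < (q - 1) / T by rewrite divr_gt0 //; lra.
have p1 : (q - 1) / T < 1 by rewrite ltr_pdivrMr // mul1r /T; lra.
have := @Hq_cross_le q a ((q - 1) / T) q2; rewrite a0 a1 p0 p1 => /(_ isT isT).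
have -> : 1 - (q - 1) / T = q ^+ 3 / T by rewrite /T; field; rewrite -/T gt_eqF.
rewrite !ln_div ?posrE ?lnXn //; last by lra.
have LT : ln T <= 3 * ln q + (q - 1) / q ^+ 3.
  have -> : T = q ^+ 3 * (1 + (q - 1) / q ^+ 3) by rewrite /T; field; lra.
  have z0 : 0 <= (q - 1) / q ^+ 3 by rewrite divr_ge0; lra.
  rewrite lnM ?posrE //; last by lra.
  by rewrite lnXn // mulr_natl lerD2l le_ln1Dx //; lra.
move=> h.
have {}h : Hq q a * ln q <= (q - 1) / q ^+ 3 + 3 * a * ln q.
  by apply: le_trans h _; lra.
have l0 := ln_q_gt0 q2.
rewrite -(ltr_pM2r l0); apply: le_lt_trans h _.
rewrite -ltrBrDr -mulrBl.
have c0 : (23 / 50 * q + 27 / 50) / (q * (q + 1)) <= 1 / (q + 1) - 3 * a.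
  have : 3 * a <= 3 * (9 / 50 * ((q - 1) / (q * (q + 1)))) by lra.
  have -> : (23 / 50 * q + 27 / 50) / (q * (q + 1)) =
    1 / (q + 1) - 3 * (9 / 50 * ((q - 1) / (q * (q + 1)))) by field; lra.
  lra.
have c00 : 0 < (23 / 50 * q + 27 / 50) / (q * (q + 1)) by rewrite divr_gt0 ?mulr_gt0; lra.
apply: (@lt_le_trans _ _ ((23 / 50 * q + 27 / 50) / (q * (q + 1)) * (2 * (1 - 1 / s)))).
  have -> : (23 / 50 * q + 27 / 50) / (q * (q + 1)) * (2 * (1 - 1 / s)) =
     (s - 1) * (s * (q * (23 / 25 * q + 27 / 25))) / (q ^+ 3 * (q + 1)).
    by rewrite -s2; field; rewrite -?s2 ?gt_eqF //; nra.
  have -> : (q - 1) / q ^+ 3 = (s - 1) * ((s + 1) * (q + 1)) / (q ^+ 3 * (q + 1)).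
    by rewrite -{1}s2; field; lra.
  (* Without the common factor [s - 1] the claim is [s^3 + s^2 + s + 1 < (23/25) s^5 + (27/25) s^3],
     linear in powers of [s] that are compared through [s >= 141/100]. *)
  rewrite ltr_pM2r ?invr_gt0 ?mulr_gt0 ?ltr_pM2l //; try lra.
  have b2 : 141 / 100 * s <= s ^+ 2 by nra.
  have b3 : 141 / 100 * s ^+ 2 <= s ^+ 3.
    by rewrite (exprS s 2) ler_wpM2r // sqr_ge0.
  have b5 : 198 / 100 * s ^+ 3 <= s ^+ 5.
    by rewrite (exprD s 2 3) ler_wpM2r ?exprn_ge0 ?(ltW s0) //; nra.
  rewrite -s2; lra.
apply: ler_pM => //; first exact: ltW.
by rewrite mulr_ge0 // subr_ge0 ler_pdivrMr //; lra.
Qed.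

Local Open Scope classical_set_scope.

(* Stated over an abstract [R]: the topology of the concrete reals is not found by unification. *)
Lemma entropy_ivt (R : realType) (q b : R) :
  let A (z : R) := (q - 1 - (q - 2) * z - 2 * Num.sqrt ((q - 1) * z * (1 - z))) / q in
  let H (x : R) := (x * ln (q - 1) - x * ln x - (1 - x) * ln (1 - x)) / ln q in
  0 <= b -> (forall y, 0 <= y <= b -> 0 < A ((q - 1) * y) < 1) ->
  0 <= H (A ((q - 1) * 0)) - 0 -> H (A ((q - 1) * b)) - b <= 0 ->
  exists2 y, 0 <= y <= b & H (A ((q - 1) * y)) - y = 0.
Proof.
move=> A H b0 A01 f0 fb.
have cH x : 0 < x < 1 -> {for x, continuous H}.
  move=> /andP[x0 x1].
  have c1 : (fun z : R => 1 - z) @ x --> 1 - x by apply: cvgB; [exact: cvg_cst|exact: cvg_id].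
  have cl : (fun z : R => ln z) @ x --> ln x by exact: continuous_ln.
  have cl1 : (fun z : R => ln (1 - z)) @ x --> ln (1 - x).
    apply: (@continuous_comp _ _ _ (fun z : R => 1 - z) (@ln R)) => //.
    by apply: continuous_ln; rewrite subr_gt0.
  exact: cvgMl (cvgB (cvgB (cvgMl cvg_id) (cvgM cvg_id cl)) (cvgM c1 cl1)).
have cA d : {for d, continuous A}.
  have c1 : (fun z : R => 1 - z) @ d --> 1 - d by apply: cvgB; [exact: cvg_cst|exact: cvg_id].
  have cs : (fun z : R => Num.sqrt ((q - 1) * z * (1 - z))) @ d
      --> Num.sqrt ((q - 1) * d * (1 - d)).
    apply: (@continuous_comp _ _ _ (fun z : R => (q - 1) * z * (1 - z)) Num.sqrt).
      exact: cvgM (cvgMr cvg_id) c1.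
    exact: sqrt_continuous.
  exact: cvgMl (cvgB (cvgB (cvg_cst _) (cvgMr cvg_id)) (cvgMr cs)).
pose f y := H (A ((q - 1) * y)) - y.
have cf : {within `[0, b], continuous f}.
  apply: continuous_in_subspaceT => y; rewrite inE /= in_itv /= => yb.
  apply: cvgB; last exact: cvg_id.
  apply: (@continuous_comp _ _ _ (fun z : R => A ((q - 1) * z)) H); last exact/cH/A01.
  apply: (@continuous_comp _ _ _ (fun z : R => (q - 1) * z) A); last exact: cA.
  by apply: cvgMr; exact: cvg_id.
have [|y] := @IVT _ f 0 b 0 b0 cf.
  by rewrite ge_min le_max f0 fb orbT.
by rewrite in_itv /= => yb fy; exists y.
Qed.

Local Close Scope classical_set_scope.

(** [Mq q ((q - 1) * y) - y] is [1] at [0] and negative at [1 / (q + 1)], so the intermediate value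
    theorem gives a zero strictly inside. *)
Lemma mrrw_fixpoint (q : RealR) : 2 <= q ->
  exists y, [/\ 0 < y, y < 1 / (q + 1) & Mq q ((q - 1) * y) = y].
Proof.
move=> q2; set b := 1 / (q + 1).
have b0 : 0 < b by rewrite divr_gt0; lra.
have bE : (q - 1) * b = (q - 1) / (q + 1) by rewrite /b mulrA mulr1.
have f0 : Mq q ((q - 1) * 0) - 0 = 1 by rewrite mulr0 Mq0 // subr0.
have fb : Mq q ((q - 1) * b) - b < 0 by rewrite bE subr_lt0 Mq_endpoint_lt.
have q1 : (q - 1) / q < 1 by rewrite ltr_pdivrMr; lra.
have rng y : 0 <= y <= b ->
    0 < (q - 1 - (q - 2) * ((q - 1) * y)
         - 2 * Num.sqrt ((q - 1) * ((q - 1) * y) * (1 - (q - 1) * y))) / q < 1.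
  move=> /andP[y0 yb]; set d := (q - 1) * y.
  have d0 : 0 <= d by rewrite mulr_ge0 //; lra.
  have dq : d < (q - 1) / q.
    apply: (@le_lt_trans _ _ ((q - 1) * b)); first by rewrite ler_wpM2l //; lra.
    by rewrite bE ltr_pM2l ?ltf_pV2 ?posrE; lra.
  rewrite mrrw_radiusE //; last by lra.
  by rewrite mrrw_radius_gt0 //= (le_lt_trans _ q1) // mrrw_radius_le // ltW.
have [||y /andP[y0 yb]] := @entropy_ivt RealR q b (ltW b0) rng.
- by rewrite -HqE f0 ler01.
- by rewrite -HqE ltW.
rewrite -HqE -/(Mq q _) => /eqP; rewrite subr_eq0 => /eqP fy.
exists y; split => //.
- rewrite lt_neqAle y0 andbT; apply: contraTneq isT => e.
  by move: fy; rewrite -e mulr0 Mq0 // => /eqP; rewrite oner_eq0.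
- rewrite lt_neqAle yb andbT; apply: contraTneq isT => e.
  by move: fb; rewrite -e fy subrr ltxx.
Qed.

(** A decreasing function crosses the diagonal once; [z <= 1 / (q + 1)] keeps [(q - 1) * z] below
    [(q - 1) / q]. This serves both uniqueness of [c] and the strict gap just above [y]. *)
Lemma mrrw_below_diagonal (q y z : RealR) : 2 <= q -> 0 < y -> y < z -> z <= 1 / (q + 1) ->
  Mq q ((q - 1) * y) = y -> Mq q ((q - 1) * z) < z.
Proof.
move=> q2 y0 yz zb fy; apply: lt_trans (yz); rewrite -[ltRHS]fy.
apply: Mq_lt => //; [by rewrite mulr_gt0 //; lra|by rewrite ltr_pM2l //; lra|].
apply: (@le_lt_trans _ _ ((q - 1) * (1 / (q + 1)))); first by rewrite ler_wpM2l //; lra.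
by rewrite mul1r ltr_pM2l ?ltf_pV2 ?posrE; lra.
Qed.

(** * The MRRW bound for linear codes *)

(* With [k = sqrt (q - 1)], [a = sqrt (1 - d)], [b = sqrt d], one has
   [rho = (k a - b)^2 / q] and [1 - rho = (a + k b)^2 / q]. *)
Lemma mrrw_radius_params (q d : RealR) : 2 <= q -> 0 <= d -> d < (q - 1) / q ->
  let rho := mrrw_radius q d in
  exists s t : RealR, [/\ 0 < t, 0 <= s, (q - 1) * t * (1 - rho) = s, rho = s * t &
    (q - 1) * rho + 1 - rho + 2 * s = q * (1 - d)].
Proof.
move=> q2 d0 dq rho.
have q0 : 0 < q by lra.
have d1 : d < 1 by apply: lt_le_trans dq _; rewrite ler_pdivrMr; lra.
set k := Num.sqrt (q - 1); set a := Num.sqrt (1 - d); set b := Num.sqrt d.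
have k0 : 0 < k by rewrite sqrtr_gt0; lra.
have a0 : 0 < a by rewrite sqrtr_gt0; lra.
have b0 : 0 <= b by rewrite sqrtr_ge0.
have k2 : k ^+ 2 = q - 1 by rewrite sqr_sqrtr; lra.
have a2 : a ^+ 2 = 1 - d by rewrite sqr_sqrtr; lra.
have b2 : b ^+ 2 = d by rewrite sqr_sqrtr; lra.
have rE : rho = (k * a - b) ^+ 2 / q by rewrite /rho /mrrw_radius sqrtrM //; lra.
have e0 : 0 < k * a - b.
  rewrite subr_gt0 /k /a /b -sqrtrM; last by lra.
  rewrite ltr_sqrt ?mulr_gt0; try lra.
  by move: dq; rewrite ltr_pdivlMr //; lra.
have c0 : 0 < a + k * b by rewrite ltr_pwDl // mulr_ge0 // ltW.
have rE' : 1 - rho = (a + k * b) ^+ 2 / q.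
  apply: (mulIf (lt0r_neq0 q0)); rewrite rE mulrBl !divfK ?gt_eqF // mul1r.
  have -> : (k * a - b) ^+ 2 = k ^+ 2 * a ^+ 2 - 2 * (k * a * b) + b ^+ 2 by ring.
  have -> : (a + k * b) ^+ 2 = k ^+ 2 * b ^+ 2 + 2 * (k * a * b) + a ^+ 2 by ring.
  by rewrite k2 a2 b2; ring.
exists (k * (k * a - b) * (a + k * b) / q), ((k * a - b) / (k * (a + k * b))); split.
- by rewrite divr_gt0 // mulr_gt0.
- by rewrite !mulr_ge0 ?invr_ge0 // ltW.
- by rewrite rE' -k2; field; rewrite !gt_eqF.
- by rewrite rE; field; rewrite !gt_eqF.
- have -> : (q - 1) * rho + 1 - rho = (q - 1) * rho + (1 - rho) by ring.
  rewrite rE' rE -k2.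
  transitivity (((k ^+ 2 + 1) * a) ^+ 2 / q); first by field; rewrite gt_eqF.
  by rewrite k2 exprMn a2 subrK; field; rewrite gt_eqF.
Qed.

(** Chernoff's bound at its minimiser [t = rho / ((q - 1) (1 - rho))]; the condition [t <= 1]
    amounts to [rho <= (q - 1) / q]. *)
Lemma ln_card_ball_le (F : finFieldType) (I : finType) (r : nat) (rho : RealR) :
  0 < rho -> rho <= (qR F - 1) / qR F -> r%:R <= rho * #|I|%:R ->
  ln (#|[set x : {ffun I -> F} | (hwt x <= r)%N]|%:R : RealR) <=
    #|I|%:R * (Hq (qR F) rho * ln (qR F)).
Proof.
move=> r0 rq rn.
have q2 : 2 <= qR F by rewrite /qR ler_nat finNzRing_gt1.
have q1E : #|F|.-1%:R = qR F - 1 by rewrite -subn1 natrB // (ltnW (finNzRing_gt1 F)).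
set q := qR F in rq q2 q1E *; set n := #|I|%:R in rn *.
move: rq; rewrite ler_pdivlMr => [rq|]; last by lra.
have r1 : 0 < 1 - rho by nra.
have Q0 : 0 < (q - 1) * (1 - rho) by rewrite mulr_gt0 //; lra.
pose t := rho / ((q - 1) * (1 - rho)).
have t0 : 0 < t by rewrite divr_gt0.
have t1 : t <= 1 by rewrite ler_pdivrMr //; lra.
have := @card_ball_le F RealR I r t; rewrite (ltW t0) t1 => /(_ isT).
set B := #|_|%:R; rewrite q1E.
have -> : 1 + (q - 1) * t = (1 - rho)^-1.
  by rewrite /t; field; rewrite (gt_eqF r1) gt_eqF //; lra.
have B0 : 0 < B.
  rewrite ltr0n card_gt0; apply/set0Pn; exists 0.
  by rewrite inE /hwt big1 // => i _; rewrite ffunE eqxx.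
move=> h.
have {h} : ln (B * t ^+ r) <= ln ((1 - rho)^-1 ^+ #|I|).
  rewrite ler_ln // posrE; first by rewrite mulr_gt0 // exprn_gt0.
  by rewrite exprn_gt0 // invr_gt0.
rewrite lnM ?posrE ?exprn_gt0 // !lnXn ?invr_gt0 // lnV ?posrE // => h.
rewrite Hq_lnE //.
have lt0 : ln t <= 0 by rewrite ln_le0.
have lE : ln t = ln rho - ln (q - 1) - ln (1 - rho).
  rewrite /t ln_div ?posrE // lnM ?posrE //; lra.
have hr : r%:R * - ln t <= rho * n * - ln t by rewrite ler_wpM2r // oppr_ge0.
have -> : n * (rho * ln (q - 1) - rho * ln rho - (1 - rho) * ln (1 - rho)) =
   rho * n * - ln t - n * ln (1 - rho) by rewrite lE; ring.
have e1 : - ln (1 - rho) *+ #|I| = - (n * ln (1 - rho)) by rewrite mulNrn /n mulr_natl.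
have e2 : ln t *+ r = r%:R * ln t by rewrite mulr_natl.
move: h hr; rewrite e1 e2 !mulrN.
move: (ln B) (n * ln (1 - rho)) (r%:R * ln t) (rho * n * ln t) => u v w z.
clear; lra.
Qed.

Lemma bound_le (a : RealR) (n : nat) : 0 <= a -> (Num.bound a <= n)%N -> a <= n%:R.
Proof.
by move=> a0 an; apply: le_trans (ltW (archi_boundP a0)) _; rewrite ler_nat.
Qed.

(** A code with rate about [z] and relative distance about [(q - 1) z] is tested at the smaller
    distance [(q - 1) y]. The surplus pays for all losses, so a ball of relative radius [rho] has at
    least a constant times [q^(k - 1)] points, against [Hq q rho < y < z]. *)
Lemma no_large_linear_code (F : finFieldType) (y z : RealR) :
  0 < y -> y < z -> z <= 1 / (qR F + 1) -> Mq (qR F) ((qR F - 1) * y) < y ->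
  exists N : nat, forall (k : nat) (I : finType) (g : I -> 'rV[F]_k),
    (N <= #|I|)%N -> (1 < k)%N ->
    #|I|%:R * z <= k.-1%:R -> k.-1%:R <= (#|I|%:R + 1) * z ->
    exists2 u : 'cV[F]_k, u != 0 & (#|[set i | ((g i *m u) != 0)%R]| < #|F|.-1 * k.-1)%N.
Proof.
have F1 := finNzRing_gt1 F.
have q2 : 2 <= qR F by rewrite /qR ler_nat.
have q1E : #|F|.-1%:R = qR F - 1 by rewrite -subn1 natrB // (ltnW F1).
have qE : #|F|%:R = qR F by [].
move: (qR F) q2 q1E qE (@ln_card_ball_le F) => q q2 q1E qE ball y0 yz zq Myy.
have q0 : 0 < q by lra.
have q1 : 0 < q - 1 by lra.
set dlt := (q - 1) * y in Myy.
have dlt0 : 0 < dlt by rewrite mulr_gt0 //; lra.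
have zq' : z * (q + 1) <= 1 by move: zq; rewrite ler_pdivlMr //; lra.
have yq : y * q < 1.
  by apply: lt_le_trans zq'; rewrite mulrDr mulr1 ltr_wpDr ?ltr_pM2r //; lra.
have dq : dlt < (q - 1) / q.
  by rewrite ltr_pdivlMr // /dlt -mulrA -[ltRHS]mulr1 ltr_pM2l //; lra.
have [s [t [t0 s0 sE rE LE]]] := mrrw_radius_params q2 (ltW dlt0) dq.
have := mrrw_radius_gt0 q2 (ltW dlt0) dq.
have := mrrw_radius_le q2 (ltW dlt0) (ltW dq).
rewrite MqE // in Myy; last first.
  rewrite (ltW dlt0) /=; apply: le_trans (ltW dq) _; rewrite ler_pdivrMr //; lra.
move: (mrrw_radius q dlt) sE rE LE Myy => rho sE rE LE Hy rq r0.
have r1 : rho <= 1 by apply: le_trans rq _; rewrite ler_pdivrMr //; lra.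
(* The eigenvalue surplus per coordinate: [q (1 - (q - 1) y) - q (1 - (q - 1) z)]. *)
pose gam := q * (q - 1) * (z - y).
have gam0 : 0 < gam by rewrite /gam !mulr_gt0 //; lra.
pose m := (Num.bound (8 * s / gam)).+2.
have m1 : 8 * s / gam <= m%:R - 1.
  have h : 0 <= 8 * s / gam by apply: divr_ge0 (ltW gam0); apply: mulr_ge0 => //; rewrite ler0n.
  have -> : m%:R = (Num.bound (8 * s / gam))%:R + 1 + 1 :> RealR by rewrite !natr1.
  by have := archi_boundP h; lra.
have m2 : 1 < m%:R - 1 + 1 :> RealR by rewrite subrK ltr1n.
have mgam : 2 * s / (m%:R - 1) <= gam / 4.
  move: m1; rewrite ler_pdivrMr // => m1; rewrite ler_pdivrMr; last by lra.
  nra.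
set C := (m%:R + 1) * (2 / t + (q - 1)).
have C0 : 0 <= C.
  have h : 0 < 2 / t by rewrite divr_gt0.
  by rewrite mulr_ge0 //; lra.
have l0 := ln_q_gt0 q2.
pose e := ln q * (z - Hq q rho).
have e0 : 0 < e by rewrite mulr_gt0 //; lra.
(* In turn: [C] costs at most a quarter of [gam n], the window fits below [rho n], the exponential
   gap [e n] beats the constant [gam / 4], and [n >= 1]. *)
exists (maxn (maxn (Num.bound (4 * C / gam)) (Num.bound (m%:R / rho)))
   (maxn (Num.bound ((`|ln (gam / 4)| + 1) / e)) 1)) => k I g.
rewrite !geq_max => /andP[/andP[nC nm] /andP[nl n1]] k1 nz kz.
apply/not_notP => noU.
have wt (u : 'cV[F]_k) : u != 0 -> (#|F|.-1 * k.-1 <= #|[set i | ((g i *m u) != 0)%R]|)%N.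
  by move=> u0; rewrite leqNgt; apply/negP => lt; apply: noU; exists u.
have {}nC : 4 * C <= gam * #|I|%:R.
  rewrite [leRHS]mulrC -ler_pdivrMr // bound_le //.
  by apply: divr_ge0 (ltW gam0); apply: mulr_ge0 => //; rewrite ler0n.
have {}nm : m%:R <= rho * #|I|%:R.
  by rewrite [leRHS]mulrC -ler_pdivrMr // bound_le // divr_ge0 // ltW.
have {}nl : `|ln (gam / 4)| + 1 <= e * #|I|%:R.
  by rewrite [leRHS]mulrC -ler_pdivrMr // bound_le // divr_ge0 ?addr_ge0 ?normr_ge0 // ltW.
have {}n1 : 1 <= #|I|%:R :> RealR by rewrite ler1n.
pose r := Num.trunc (rho * #|I|%:R).
have rn0 : 0 <= rho * #|I|%:R by rewrite mulr_ge0 // ltW.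
have /andP[rlo rhi] := truncn_itv rn0; rewrite -/r -natr1 in rlo rhi.
have mr : (m <= r)%N by rewrite truncn_ge_nat.
have := @code_ball_bound F RealR k I g (#|F|.-1 * k.-1) m r rho s t k1 wt t0 s0.
rewrite rlo rhi natrM q1E qE => /(_ sE rE isT mr isT r1).
have := ball I r rho r0 rq rlo.
have B1 : 1 <= #|[set x : {ffun I -> F} | (hwt x <= r)%N]|%:R :> RealR.
  rewrite ler1n card_gt0; apply/set0Pn; exists 0.
  by rewrite inE /hwt big1 // => i _; rewrite ffunE eqxx.
rewrite natrX qE.
move: (#|[set x | _]|%:R) B1 => B B1 lnB.
have kE : q ^+ k = q * q ^+ k.-1 by rewrite -exprS prednK // ltnW.
set n := #|I|%:R in nz kz nC nm nl n1 rn0 rlo rhi lnB *.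
set K := k.-1%:R in nz kz *.
set X := (X in q ^+ k * X <= _) => hX.
have XE : X = n * (q * (1 - dlt) - 2 * s / (m%:R - 1)) - C - q * (n - (q - 1) * K).
  by rewrite /X -LE.
have n0 : 0 <= n by exact: le_trans n1.
(* The window width and [C] each use up at most a quarter of the surplus [gam n]. *)
have Xlo : gam * n / 2 <= X.
  rewrite XE.
  have h1 : n * (2 * s / (m%:R - 1)) <= n * (gam / 4) by rewrite ler_wpM2l.
  have h2 : q * (q - 1) * (n * z) <= q * (q - 1) * K by rewrite ler_wpM2l // ltW // mulr_gt0.
  have h3 : gam * n = q * (q - 1) * (n * z) - q * n * dlt by rewrite /gam /dlt; ring.
  move: h1 h2 h3 nC; clear; lra.
have Kn : (q - 1) * K <= 2 * n.
  have h1 : (q - 1) * K <= (q - 1) * ((n + 1) * z) by rewrite ler_wpM2l // ltW.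
  have h2 : (q - 1) * z <= 1 by move: zq' y0 yz; clear; lra.
  have h3 : (n + 1) * ((q - 1) * z) <= (n + 1) * 1 by rewrite ler_wpM2l // addr_ge0.
  by move: h1 h3 n1; clear; lra.
have Q0 : 0 < q ^+ k.-1 by rewrite exprn_gt0.
(* Both sides carry a factor linear in [n], by [Xlo] and [Kn]; it cancels. *)
have fin : q ^+ k.-1 * (gam / 4) <= B.
  have h1 : q ^+ k * (gam * n / 2) <= q * ((q - 1) * K) * B.
    by apply: le_trans (hX); rewrite ler_wpM2l // exprn_ge0 // ltW.
  have h2 : q * ((q - 1) * K) * B <= q * (2 * n) * B.
    by rewrite ler_wpM2r ?(le_trans ler01 B1) // ler_wpM2l // ltW.
  have np : 0 < n by exact: lt_le_trans n1.
  have qn0 : 0 < 2 * q * n by rewrite (mulr_gt0 (mulr_gt0 _ q0) np) // ltr0n.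
  rewrite -(ler_pM2l qn0); move: (le_trans h1 h2); rewrite kE.
  by congr (_ <= _); [field|ring].
have {fin} : ln (q ^+ k.-1 * (gam / 4)) <= ln B.
  rewrite ler_ln // posrE; first by rewrite mulr_gt0 // divr_gt0.
  exact: lt_le_trans ltr01 B1.
have g4 : 0 < gam / 4 by rewrite divr_gt0.
rewrite lnM ?posrE // lnXn // -[ln q *+ _]mulr_natl -/K => h.
have h1 : n * z * ln q <= K * ln q by rewrite ler_wpM2r // ltW.
have h2 := ler_norm (- ln (gam / 4)); rewrite normrN in h2.
have h3 : e * n = n * z * ln q - n * (Hq q rho * ln q) by rewrite /e; ring.
move: lnB h h1 h2 h3 nl; clear; lra.
Qed.

(** * Strong blocking sets *)

(* Zero vectors change neither the weights nor the dimension, so [S] may be padded to a prescribed length [n]. *)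
Lemma strong_blocking_padded (F : finFieldType) (k n : nat) (S : {set 'M[F]_k}) :
  (1 < k)%N -> strong_blocking_set S -> (#|S| <= n)%N ->
  exists (I : finType) (g : I -> 'rV[F]_k), #|I| = n /\
    forall u : 'cV[F]_k, u != 0 ->
      (#|F|.-1 * k.-1 <= #|[set i | ((g i *m u) != 0)%R]|)%N.
Proof.
move=> k1 Sbl Sn.
pose g (i : {P | P \in S} + 'I_(n - #|S|)) : 'rV[F]_k :=
  if i is inl P then nz_row (val P) else 0.
exists ({P | P \in S} + 'I_(n - #|S|))%type, g; split.
  by rewrite card_sum card_sig card_ord subnKC.
move=> u u0; apply: leq_trans (strong_blocking_weight k1 Sbl u0) _.
have <- : #|[set i : {P | P \in S} | ((nz_row (val i) *m u) 0 0 != 0)%R]| =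
    #|[set P in S | ((nz_row P *m u) 0 0 != 0)%R]|.
  rewrite -(card_imset _ val_inj); apply: eq_card => P; rewrite !inE.
  apply/imsetP/andP => [[[Q QS]]|[PS h]]; first by rewrite inE => h ->.
  by exists (Sub P PS); rewrite ?inE.
have inl_inj : injective (@inl {P | P \in S} 'I_(n - #|S|)) by move=> a b [].
rewrite -(card_imset _ inl_inj); apply/subset_leq_card/fintype.subsetP => i /imsetP[P].
by rewrite !inE => h -> /=; apply: contraNneq h => ->; rewrite mxE.
Qed.

Theorem theorem1p4 (F : finFieldType) :
  exists c : RealR,
    [/\ 1 < c,
        Mq (qR F) ((qR F - 1) / (c * (qR F + 1))) = 1 / (c * (qR F + 1)),
        (forall x : RealR, 1 <= x ->
           Mq (qR F) ((qR F - 1) / (x * (qR F + 1))) = 1 / (x * (qR F + 1)) ->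
           x = c) &
        (forall eps : RealR, 0 < eps ->
           exists K : nat, forall k : nat, (K <= k)%N ->
             forall S : {set 'M[F]_k}, strong_blocking_set S ->
               (c - eps) * (qR F + 1) * (k%:R - 1) <= (#|S|)%:R)].
Proof.
have q2 : 2 <= qR F by rewrite /qR ler_nat finNzRing_gt1.
set q := qR F in q2 *.
have q10 : 0 < q + 1 by lra.
have [y [y0 yq fy]] := mrrw_fixpoint q2.
have sub (x : RealR) : (q - 1) / (x * (q + 1)) = (q - 1) * (1 / (x * (q + 1))).
  by rewrite mul1r.
have inv (x : RealR) : 0 < x -> 1 / (1 / (x * (q + 1)) * (q + 1)) = x.
  by move=> x0; field; rewrite !gt_eqF.
pose c := 1 / (y * (q + 1)).
have c1 : 1 < c.
  by rewrite /c ltr_pdivlMr ?mulr_gt0 // mul1r; move: yq; rewrite ltr_pdivlMr.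
have c0 : 0 < c by lra.
have yE : 1 / (c * (q + 1)) = y by rewrite /c; field; rewrite !gt_eqF.
have rate (x1 x2 : RealR) : 0 < x1 -> x1 < x2 -> 1 / (x2 * (q + 1)) < 1 / (x1 * (q + 1)).
  move=> x10 x12; rewrite !mul1r ltf_pV2 ?posrE ?mulr_gt0 ?ltr_pM2r //; exact: lt_trans x12.
have rate1 (x : RealR) : 1 <= x -> 1 / (x * (q + 1)) <= 1 / (q + 1).
  by move=> x1; rewrite !mul1r lef_pV2 ?posrE ?mulr_gt0 ?ler_peMl //; lra.
exists c; split => //.
- by rewrite sub yE.
- move=> x x1; rewrite sub; set z := 1 / _ => fz.
  have x0 : 0 < x by lra.
  have z0 : 0 < z by rewrite divr_gt0 // mulr_gt0.
  suff zy : z = y by rewrite -(inv x x0) -/z zy.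
  (* Whichever solution is larger would lie strictly below the diagonal. *)
  have [lt|lt|//] := ltrgtP z y.
    by have := mrrw_below_diagonal q2 z0 lt (ltW yq) fz; rewrite fy ltxx.
  by have := mrrw_below_diagonal q2 y0 lt (rate1 x x1) fy; rewrite fz ltxx.
move=> eps eps0.
(* The maximum keeps [c' > 1] even for large [eps], hence [z <= 1 / (q + 1)]. *)
pose c' := Num.max (c - eps) ((1 + c) / 2).
have c'1 : 1 < c' by rewrite lt_max; apply/orP; right; lra.
have c'c : c' < c by rewrite gt_max; apply/andP; split; lra.
have c'0 : 0 < c' by lra.
(* An intermediate constant, giving [y < w < z] with [Mq] already below the diagonal at [w]. *)
pose c'' := (c' + c) / 2.
pose z := 1 / (c' * (q + 1)); pose w := 1 / (c'' * (q + 1)).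
have w0 : 0 < w by rewrite divr_gt0 // mulr_gt0 // /c''; lra.
have wz : w < z by apply: rate => //; rewrite /c''; lra.
have yw : y < w by rewrite -yE; apply: rate; rewrite /c''; lra.
have zq : z <= 1 / (q + 1) by apply: rate1; exact: ltW.
have Mw : Mq q ((q - 1) * w) < w.
  by apply: (mrrw_below_diagonal q2 y0 yw _ fy); apply: le_trans zq; exact: ltW.
have [N noC] := no_large_linear_code w0 wz zq Mw.
have z0 : 0 < z by apply: lt_trans wz.
exists (N + 2)%N => k Nk S Sbl.
have k1 : (1 < k)%N by apply: leq_trans Nk; rewrite leq_addl.
have Nk1 : (N <= k.-1)%N.
  by move: Nk; rewrite addn2; clear; case: k => [|k]; rewrite ?ltnS //; exact: ltnW.
have kE : k%:R - 1 = k.-1%:R :> RealR by rewrite -subn1 natrB // ltnW.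
rewrite kE leNgt; apply/negP => lt.
have zV : c' * (q + 1) = z^-1 by rewrite /z mul1r invrK.
have {}lt : #|S|%:R < k.-1%:R / z.
  apply: lt_le_trans lt _; rewrite mulrC -zV ler_wpM2l ?ler0n //.
  by rewrite ler_pM2r // le_max lexx.
have R0 : 0 <= k.-1%:R / z by rewrite divr_ge0 ?ler0n // ltW.
(* The length to pad to: the largest [n] with [n z <= k - 1], so that also [k - 1 < (n + 1) z]. *)
pose n := Num.trunc (k.-1%:R / z).
have /andP[nlo nhi] := truncn_itv R0; rewrite -/n -natr1 in nlo nhi.
have Sn : (#|S| <= n)%N by rewrite truncn_ge_nat // ltW.
have [I [g [In wt]]] := strong_blocking_padded k1 Sbl Sn.
have NI : (N <= #|I|)%N.
  rewrite In truncn_ge_nat // ler_pdivlMr //.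
  have z1 : z <= 1.
    apply: le_trans zq _; rewrite ler_pdivrMr //; lra.
  apply: (@le_trans _ _ N%:R); first by rewrite ler_piMr // ler0n.
  by rewrite ler_nat.
have [||u u0] := noC k I g NI k1.
- by rewrite In -ler_pdivlMr.
- by rewrite In -ler_pdivrMr // ltW.
by rewrite ltnNge wt.
Qed.
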